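(* Let $\mathcal{X}$ be a finite set, $\pi$ a strictly positive probability distribution on $\mathcal{X}$ with $\pi_{\min}:=\min_x\pi(x)>0$, and $P$ an irreducible, aperiodic, $\pi$-reversible transition matrix on $\mathcal{X}$ with absolute spectral gap $\gamma_*$. Let $\alpha\in(0,1)\cup(1,+\infty)$ and $0<\varepsilon<\min\left\{\frac{1}{2|\alpha-1|},\frac{4\alpha}{|\alpha-1|}\right\}$. Then $$\bar t_{\mathrm{mix}}^{(D_\alpha)}(\varepsilon,P)\le\begin{cases}\dfrac1{\gamma_*}\left(\ln\dfrac{2\alpha}{(\alpha-1)\pi_{\min}}+\ln\dfrac1\varepsilon\right),&\alpha>1,\\[2mm]\dfrac1{\gamma_*}\left(\ln\dfrac{8\alpha}{(1-\alpha)\pi_{\min}}+\ln\dfrac1\varepsilon\right),&0<\alpha<1,\end{cases}$$ and $$\bar t_{\mathrm{mix}}^{(D_\alpha)}(\varepsilon,P)\ge\begin{cases}\dfrac{1}{2\ln\frac1{1-\gamma_*}}\left(\ln\dfrac{\pi_{\min}^2}{8}+\ln\dfrac1\varepsilon\right),&\alpha>1,\\[2mm]\dfrac{1}{2\ln\frac1{1-\gamma_*}}\left(\ln\dfrac{\pi_{\min}^2\alpha}{16}+\ln\dfrac1\varepsilon\right),&0<\alpha<1.\end{cases}$$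
   Context: $P$ is $\pi$-reversible if $\pi(x)P(x,y)=\pi(y)P(y,x)$ for all $x,y$. The absolute spectral gap is $\gamma_*:=1-\lambda_*$ with $\lambda_*:=\max\{|\lambda|:\lambda\text{ an eigenvalue of }P,\ \lambda\ne1\}$. $\Pi$ is the matrix all of whose rows equal $\pi$, i.e. $\Pi(x,y)=\pi(y)$. For transition matrices $M,L$ with $L$ having positive entries, $D_\alpha(M\|L):=\frac1{\alpha-1}\left(\sum_{x}\pi(x)\sum_yL(x,y)\left(\frac{M(x,y)}{L(x,y)}\right)^\alpha-1\right)$. The $\pi$-weighted $\alpha$-divergence mixing time is $\bar t_{\mathrm{mix}}^{(D_\alpha)}(\varepsilon,P):=\inf\{t>0:D_\alpha(P^t\|\Pi)<\varepsilon\}$, $t$ ranging over positive integers. When $\gamma_*=1$, $1/\ln\frac{1}{1-\gamma_*}$ is read as $0$. *)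

(* Defs.v *)
From HB Require Import structures.
From mathcomp Require Import all_boot all_order all_algebra.
From mathcomp Require Import complex.
From mathcomp Require Import all_classical all_reals all_analysis.

Set Implicit Arguments.
Unset Strict Implicit.
Unset Printing Implicit Defensive.

Import Order.TTheory GRing.Theory Num.Theory.

Local Open Scope classical_set_scope.
Local Open Scope ring_scope.

(* The state space is 'I_n; distributions are row vectors, and the entry
   M x y of a transition matrix is the probability of moving from x to y. *)

Definition positive_distribution (R : realType) (n : nat) (mu : 'rV[R]_n) : Prop :=
  (forall x, 0 < mu 0 x) /\ \sum_x mu 0 x = 1.

Definition transition_matrix (R : realType) (n : nat) (P : 'M[R]_n) : Prop :=
  (forall x y, 0 <= P x y) /\ (forall x, \sum_y P x y = 1).

Definition irreducible_chain (R : realType) (n : nat) (P : 'M[R]_n) : Prop :=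
  forall x y, exists t : nat, 0 < (P ^+ t) x y.

Definition return_times (R : realType) (n : nat) (P : 'M[R]_n) (x : 'I_n) : set nat :=
  [set t | (0 < t)%N /\ 0 < (P ^+ t) x x].

(* d is the gcd of the set of return times to x. *)
Definition has_period (R : realType) (n : nat) (P : 'M[R]_n) (x : 'I_n) (d : nat) : Prop :=
  (forall t, return_times P x t -> (d %| t)%N) /\
  (forall c : nat, (forall t, return_times P x t -> (c %| t)%N) -> (c %| d)%N).

Definition aperiodic_chain (R : realType) (n : nat) (P : 'M[R]_n) : Prop :=
  forall x, has_period P x 1.

Definition reversible (R : realType) (n : nat) (mu : 'rV[R]_n) (P : 'M[R]_n) : Prop :=
  forall x y, mu 0 x * P x y = mu 0 y * P y x.

(* The default 1 never exceeds the minimum when n > 0 and mu is a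
   distribution, since then every mu 0 x is at most 1. *)
Definition min_mass (R : realType) (n : nat) (mu : 'rV[R]_n) : R :=
  \big[Num.min/1]_(x < n) mu 0 x.

(* Eigenvalues are complex, and [eigenvalue] uses row eigenvectors, which
   gives the same spectrum as column eigenvectors. The set below is finite, so
   its supremum is its maximum as soon as it is nonempty. *)
Definition lambda_star (R : realType) (n : nat) (P : 'M[R]_n) : R :=
  sup [set ComplexField.Normc.normc lam | lam in
        [set lam : R[i] | eigenvalue (map_mx (real_complex R) P) lam /\ lam != 1]].

Definition abs_spectral_gap (R : realType) (n : nat) (P : 'M[R]_n) : R :=
  1 - lambda_star P.

Definition stationary_mx (R : realType) (n : nat) (mu : 'rV[R]_n) : 'M[R]_n :=
  \matrix_(x, y) mu 0 y.

Definition alpha_divergence (R : realType) (n : nat) (mu : 'rV[R]_n) (alpha : R)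
    (M L : 'M[R]_n) : R :=
  (alpha - 1)^-1 *
  (\sum_x mu 0 x * (\sum_y L x y * (M x y / L x y) `^ alpha) - 1).

(* Extended-real valued, so that the infimum of the empty set is +oo. *)
Definition mixing_time (R : realType) (n : nat) (mu : 'rV[R]_n) (alpha eps : R)
    (P : 'M[R]_n) : \bar R :=
  ereal_inf [set (t%:R : R)%:E | t in
    [set t : nat | (0 < t)%N /\
                   alpha_divergence mu alpha (P ^+ t) (stationary_mx mu) < eps]].

(* 1 / ln (1 / (1 - gamma)), read as 0 when gamma = 1. *)
Definition inv_ln_gap (R : realType) (gamma : R) : R :=
  if gamma == 1 then 0 else (ln (1 / (1 - gamma)))^-1.

(* Main.v *)
Require Import Defs.
From HB Require Import structures.
From mathcomp Require Import all_boot all_order all_algebra.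
From mathcomp Require Import complex ring lra.
From mathcomp Require Import all_classical all_reals all_analysis.

(* Write f(x,y) = P^t(x,y) / pi(y), a density of mean 1 for pi x pi, l for
   lambda_star and m for pi_min.

   Upper bound. The matrix Q = D^(1/2) P D^(-1/2) - q^T q, with D = diag(pi) and
   q = sqrt(pi), is symmetric, its eigenvalues are 0 or eigenvalues of P other
   than 1, and Q^t has entries sqrt(pi(x) pi(y)) (f(x,y) - 1). The spectral theorem
   gives |f - 1| <= l^t / m. Since |f - 1| is small and f - 1 has mean zero, the
   divergence is at most |f - 1| up to an explicit constant. The loss from
   rounding the bound down to an integer t is absorbed by
   ln y >= 2 (y - 1) / (y + 1). That l < 1 follows from the maximum principle:
   an eigenfunction for -1 would make all return times even.

   Lower bound. A row eigenvector for an eigenvalue z <> 1 has total mass zero, so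
   z^t is an eigenvalue of P^t - Pi and |z|^t m <= E|f - 1|. The latter is
   controlled by the divergence through the Hellinger affinity:
   (E|f - 1|)^2 <= 8 (1 - E sqrt f), and Bernoulli's inequality compares
   1 - E sqrt f with D_alpha. *)

Set Implicit Arguments.
Unset Strict Implicit.
Unset Printing Implicit Defensive.

Import Order.TTheory GRing.Theory Num.Theory.

Local Open Scope ring_scope.

(** * Spectrum of real symmetric matrices *)

Lemma spectral_exp (F : fieldType) n (V U A : 'M[F]_n) (d : 'rV[F]_n) t :
  U *m V = 1%:M -> V *m U = 1%:M -> A = V *m diag_mx d *m U ->
  A ^+ t = V *m diag_mx (\row_i d 0 i ^+ t) *m U.
Proof.
move=> UV VU ->; elim: t => [|t IH].
  rewrite expr0 -[LHS]VU -[V in LHS]mulmx1; congr (_ *m _ *m _).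
  by apply/matrixP => i j; rewrite !mxE expr0.
rewrite exprS IH -!mulmxE !mulmxA -(mulmxA _ U V) UV mulmx1.
rewrite -(mulmxA V); congr (_ *m _ *m _).
by rewrite mulmx_diag; congr diag_mx; apply/rowP => i; rewrite !mxE exprS.
Qed.

(** A symmetric matrix with real entries is Hermitian, so a unitary matrix [U] diagonalizes it; [d]
    is its spectrum. The entrywise bound on powers comes from the columns of [U] having norm one. *)
Lemma symmetric_eigenvalue_diag (C : numClosedFieldType) n (A : 'M[C]_n) :
  A^T = A -> A \is a mxOver Num.real ->
  exists d : 'rV[C]_n,
    [/\ forall i, eigenvalue A (d 0 i) /\ d 0 i \is Num.real,
        forall z, eigenvalue A z -> exists i, z = d 0 i &
        forall l, (forall i, `|d 0 i| <= l) ->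
          forall t x y, `|(A ^+ t) x y| <= l ^+ t].
Proof.
move=> symA Areal.
have Aherm : A \is hermsymmx.
  apply/is_hermitianmxP/matrixP => i j; rewrite expr0 scale1r !mxE /=.
  by rewrite -[in LHS]symA mxE; apply/esym/CrealP; move/mxOverP: Areal.
have Ud : spectralmx A \is unitarymx := spectral_unitarymx A.
have /orthomx_spectralP := hermitian_normalmx Aherm.
have /mxOverP dreal := hermitian_spectral_diag_real Aherm.
rewrite (invmx_unitary Ud).
have UV := unitarymxP Ud; have VU := mulmx1C UV.
move: (spectral_diag A) (spectralmx A) dreal Ud UV VU => d U dreal Ud.
set V := map_mx _ U^T => UV VU AE.
have UA : U *m A = diag_mx d *m U by rewrite AE !mulmxA UV mul1mx.
exists d; split.
- move=> i; split=> //; apply/eigenvalueP; exists (row i U).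
    by rewrite -row_mul UA row_mul row_diag_mx -scalemxAl -rowE.
  apply/eqP => U0; have /matrixP/(_ i i) := UV.
  have /rowP Ui := U0; rewrite !mxE eqxx big1 => [/esym/eqP|j _].
    by rewrite oner_eq0.
  by have := Ui j; rewrite !mxE => ->; rewrite mul0r.
- move=> z /eigenvalueP[v vA v0]; pose w := v *m V.
  have wd : w *m diag_mx d = z *: w.
    have := vA; rewrite AE !mulmxA -/w => /(congr1 (mulmx^~ V)).
    by rewrite -(mulmxA _ U V) UV mulmx1 -scalemxAl.
  have [i wi] : exists i, w 0 i != 0.
    apply/rV0Pn; apply: contraNneq v0 => w0.
    by rewrite -[v]mulmx1 -VU mulmxA -/w w0 mul0mx.
  clearbody w; exists i; have /rowP/(_ i) := wd.
  by rewrite mul_mx_diag !mxE mulrC => /(mulIf wi).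
- move=> l dl t x y; have l0 : 0 <= l by apply: le_trans (dl x).
  rewrite (spectral_exp t UV VU AE) mul_mx_diag !mxE.
  apply: (le_trans (ler_norm_sum _ _ _)).
  have U1 j : \sum_i `|U i j| ^+ 2 = 1.
    have /matrixP/(_ j j) := VU; rewrite !mxE eqxx mulr1n => <-.
    by apply: eq_bigr => i _; rewrite !mxE normCK mulrC.
  (* AM-GM on the product of the moduli of [U i x] and [U i y]; each sum of squares is then 1. *)
  apply: (@le_trans _ _ (\sum_i (l ^+ t *
     ((`|U i x| ^+ 2 + `|U i y| ^+ 2) / 2)))).
    apply: ler_sum => i _; rewrite !mxE !normrM norm_conjC.
    rewrite mulrAC mulrC; apply: ler_pM => //.
      by rewrite normrX lerXn2r ?nnegrE.
    rewrite ler_pdivlMr // mulr_natr.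
    by rewrite -subr_ge0 addrAC -sqrrB real_exprn_even_ge0 // realB.
  by rewrite -mulr_sumr -mulr_suml big_split /= !U1 divff ?mulr1.
Qed.

Lemma map_mxX (F F' : fieldType) (f : {rmorphism F -> F'}) n (A : 'M[F]_n) t :
  map_mx f (A ^+ t) = map_mx f A ^+ t.
Proof.
elim: t => [|t IH]; first by rewrite !expr0; exact: map_mx1.
by rewrite !exprS -IH; exact: map_mxM.
Qed.

Lemma normcRE (R : realType) (r : R) :
  ComplexField.Normc.normc (real_complex R r) = `|r|.
Proof. by rewrite /= expr0n addr0 sqrtr_sqr. Qed.

(** Descends to the reals by complexifying [Q]. Complex eigenvalues [z] are kept in the second
    clause because [lambda_star] ranges over them. *)
Lemma real_symmetric_eigenvalue_diag (R : realType) n (Q : 'M[R]_n) :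
  Q^T = Q ->
  exists d : 'rV[R]_n,
    [/\ forall i, eigenvalue Q (d 0 i),
        forall z, eigenvalue (map_mx (real_complex R) Q) z ->
          exists i, z = real_complex R (d 0 i) &
        forall l, (forall i, `|d 0 i| <= l) ->
          forall t x y, `|(Q ^+ t) x y| <= l ^+ t].
Proof.
move=> symQ; have /symmetric_eigenvalue_diag[] :
    (map_mx (real_complex R) Q)^T = map_mx (real_complex R) Q.
  by rewrite map_trmx symQ.
  by apply/mxOverP => i j; rewrite mxE complex_real.
move=> d [dQ Qd dl].
have dE i : d 0 i = real_complex R (complex.Re (d 0 i)).
  by rewrite RRe_real //; case: (dQ i).
exists (\row_i complex.Re (d 0 i)); split.
- move=> i; rewrite -(eigenvalue_map (real_complex R)) mxE /=.
  by case: (dQ i); rewrite {1}dE.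
- by move=> z /Qd[i ->]; exists i; rewrite mxE -dE.
- move=> l ld t x y.
  have := dl (real_complex R l) _ t x y.
  rewrite -(map_mxX (real_complex R)) mxE -rmorphXn /= -!normcRE -lecR; apply => i.
  by have := ld i; rewrite mxE -normcRE -lecR -dE.
Qed.

(** * Reversible chains *)

Lemma min_mass_le (R : realType) n (mu : 'rV[R]_n) x : min_mass mu <= mu 0 x.
Proof. exact: bigmin_le_cond. Qed.

Lemma min_mass_gt0 (R : realType) n (mu : 'rV[R]_n) :
  (forall x, 0 < mu 0 x) -> 0 < min_mass mu.
Proof. by move=> mu0; apply/bigmin_gtP. Qed.

Lemma min_mass_le_half (R : realType) n (mu : 'rV[R]_n) : (1 < n)%N ->
  positive_distribution mu -> min_mass mu <= 1 / 2.
Proof.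
case: n mu => [|[|n]] // mu _ [mu0 mu1].
have := min_mass_le mu ord0; have := min_mass_le mu (lift ord0 ord0).
have : mu 0 ord0 + mu 0 (lift ord0 ord0) <= 1.
  rewrite -mu1 !big_ord_recl addrA lerDl.
  by apply: sumr_ge0 => i _; exact: ltW.
lra.
Qed.

Lemma transition_matrix_exp (R : realType) n (P : 'M[R]_n) t :
  transition_matrix P -> transition_matrix (P ^+ t).
Proof.
move=> [P0 P1]; elim: t => [|t [IH0 IH1]].
  split=> [x y|x]; first by rewrite mxE; case: eqP.
  rewrite (bigD1 x) //= big1 => [|y /negPf yx]; first by rewrite mxE eqxx addr0.
  by rewrite mxE eq_sym yx.
rewrite exprS; split=> [x y|x].
  by rewrite mxE; apply: sumr_ge0 => z _; exact: mulr_ge0.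
under eq_bigr do rewrite mxE.
rewrite exchange_big /= -(P1 x); apply: eq_bigr => z _.
by rewrite -mulr_sumr IH1 mulr1.
Qed.

Lemma eigenfunction_exp (R : realType) n (P : 'M[R]_n) (h : 'I_n -> R) r t :
  (forall x, \sum_y P x y * h y = r * h x) ->
  forall x, \sum_y (P ^+ t) x y * h y = r ^+ t * h x.
Proof.
move=> Ph; elim: t => [|t IH] x.
  rewrite (bigD1 x) //= big1 => [|y /negPf yx]; last first.
    by rewrite mxE eq_sym yx mul0r.
  by rewrite mxE eqxx addr0.
rewrite exprSr; under eq_bigr do rewrite mxE mulr_suml.
rewrite exchange_big /=.
under eq_bigr do (under eq_bigr do rewrite -mulrA; rewrite -mulr_sumr Ph mulrCA).
by rewrite -mulr_sumr IH mulrA exprS.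
Qed.

(** Maximum principle: at a point of maximal modulus, an average of [h] can reach that modulus only
    if [h] is constant on the support of the averaging measure. *)
Lemma extremal_eigenfunction (R : realType) n (M : 'M[R]_n) (h : 'I_n -> R) s x :
  transition_matrix M -> s ^+ 2 = 1 -> \sum_y M x y * h y = s * h x ->
  (forall y, `|h y| <= `|h x|) ->
  forall y, 0 < M x y -> h y = s * h x.
Proof.
wlog hx : h / 0 <= h x => [th|] [M0 M1] s2 Mh hmax y My.
  have [/th H|hx] := lerP 0 (h x); first exact: H.
  apply: oppr_inj; rewrite -mulrN; apply: (th (fun y => - h y)) => //.
  - by rewrite oppr_ge0 ltW.
  - by under eq_bigr do rewrite mulrN; rewrite sumrN Mh mulrN.
  - by move=> z; rewrite !normrN.
have s1 : `|s| = 1.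
  by apply/eqP; rewrite -sqrp_eq1 // real_normK ?s2 ?num_real.
have sh z : s * h z <= h x.
  apply: (le_trans (ler_norm _)); rewrite normrM s1 mul1r -[leRHS]ger0_norm //.
(* Nonnegative terms with zero sum all vanish. *)
have : \sum_z M x z * (h x - s * h z) = 0.
  under eq_bigr do rewrite mulrBr; rewrite sumrB -mulr_suml M1 mul1r.
  under eq_bigr do rewrite mulrCA.
  by rewrite -mulr_sumr Mh mulrA -expr2 s2 mul1r subrr.
move/eqP; rewrite psumr_eq0 => [/allP/(_ y)|z _]; last first.
  by rewrite mulr_ge0 // subr_ge0.
rewrite mem_index_enum => /(_ isT)/implyP/(_ isT).
rewrite mulf_eq0 gt_eqF //= subr_eq0 => /eqP ->.
by rewrite mulrA -expr2 s2 mul1r.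
Qed.

Lemma exists_max_norm (R : realType) n (h : 'I_n -> R) (x : 'I_n) :
  exists x0, forall y, `|h y| <= `|h x0|.
Proof.
case: (@Order.TotalTheory.arg_maxP _ R 'I_n x xpredT (fun i => `|h i|)) => // i _ H.
by exists i => y; exact: H.
Qed.

Section ReversibleSpectrum.
Variables (R : realType) (n : nat) (mu : 'rV[R]_n) (P : 'M[R]_n).
Hypotheses (hmu : positive_distribution mu) (hP : transition_matrix P).
Hypotheses (hirr : irreducible_chain P) (haper : aperiodic_chain P).
Hypothesis (hrev : reversible mu P).

Let mu0 x : 0 < mu 0 x. Proof. exact: hmu.1. Qed.

Lemma eigenfunction_norm_le1 (h : 'I_n -> R) r x0 : h x0 != 0 ->
  (forall x, \sum_y P x y * h y = r * h x) -> `|r| <= 1.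
Proof.
move=> h0 Ph; have [x hx] := exists_max_norm h x0.
have hx0 : 0 < `|h x| by apply: lt_le_trans (hx x0); rewrite normr_gt0.
rewrite -(ler_pM2r hx0) -normrM -Ph mul1r.
apply: (le_trans (ler_norm_sum _ _ _)).
rewrite -[leRHS]mul1r -(hP.2 x) mulr_suml; apply: ler_sum => y _.
by rewrite normrM (ger0_norm (hP.1 x y)) ler_wpM2l ?hP.1.
Qed.

(** By irreducibility some power of [P] charges [y] from a maximum point [x]; the maximum principle
    is applied to that power. *)
Lemma harmonic_const (h : 'I_n -> R) :
  (forall x, \sum_y P x y * h y = 1 * h x) -> forall x y, h x = h y.
Proof.
move=> Ph x0; have [x hx] := exists_max_norm h x0.
suff hE y : h y = h x by move=> y; rewrite !hE.
have [t Pt] := hirr x y.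
rewrite -[RHS]mul1r; apply: (extremal_eigenfunction _ _ _ hx Pt).
- exact: transition_matrix_exp.
- exact: expr1n.
- by rewrite (eigenfunction_exp t Ph) expr1n.
Qed.

(** At a maximum point [x] of the modulus, a return at time [t] forces [h x = (-1)^t h x]. If [h x]
    is nonzero, every return time is even, against period 1. *)
Lemma eigenfunctionN1_eq0 (h : 'I_n -> R) :
  (forall x, \sum_y P x y * h y = -1 * h x) -> forall x, h x = 0.
Proof.
move=> Ph x0; have [x hx] := exists_max_norm h x0.
suff hx0 : h x = 0 by have := hx x0; rewrite hx0 normr0 normr_le0 => /eqP.
have [//|hx0] := eqVneq (h x) 0.
have [_ /(_ 2%N)] := haper x; suff H t : return_times P x t -> (2 %| t)%N.
  by move=> /(_ H).
move=> [_ Pt]; have := @extremal_eigenfunction _ _ (P ^+ t) h ((-1) ^+ t) x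
  (transition_matrix_exp t hP) (sqrr_sign _ _) (eigenfunction_exp t Ph x) hx x Pt.
rewrite -signr_odd dvdn2; case: (odd t) => //= /eqP.
by rewrite expr1 mulN1r -addr_eq0 -mulr2n mulrn_eq0 (negPf hx0).
Qed.

(** Reversibility turns a row eigenvector [u] into the column eigenfunction [u / mu]. *)
Lemma reversible_eigenfunction r : eigenvalue P r ->
  exists2 h : 'I_n -> R, (exists x, h x != 0) &
    forall x, \sum_y P x y * h y = r * h x.
Proof.
move=> /eigenvalueP[u uP u0]; exists (fun x => u 0 x / mu 0 x).
  have /rV0Pn[x ux] := u0; exists x.
  by rewrite mulf_neq0 // invr_eq0 gt_eqF.
move=> x; have /rowP/(_ x) := uP; rewrite !mxE => ux.
rewrite mulrA -ux mulr_suml; apply: eq_bigr => y _.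
have := hrev x y; have := mu0 x; have := mu0 y => y0 x0 e.
have -> : P x y = mu 0 y * P y x / mu 0 x.
  by rewrite -e mulrAC divff ?mul1r // gt_eqF.
by field; rewrite !gt_eqF.
Qed.

Lemma reversible_eigenvalue r : eigenvalue P r -> `|r| < 1 \/ r = 1.
Proof.
move=> /reversible_eigenfunction[h [x hx] Ph].
have := eigenfunction_norm_le1 hx Ph; rewrite le_eqVlt => /orP[|]; last by left.
rewrite eqr_norml => /andP[/orP[/eqP|/eqP] r1 _]; first by right.
by move: hx; rewrite eigenfunctionN1_eq0 ?eqxx // => y; rewrite Ph r1.
Qed.

End ReversibleSpectrum.

(** * Symmetrization and decay of the transition density *)

Lemma eigenvalue_diag_conj (F : fieldType) n (A : 'M[F]_n) (s : 'I_n -> F) z :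
  (forall i, s i != 0) -> eigenvalue A z ->
  eigenvalue (\matrix_(i, j) (s i * A i j / s j)) z.
Proof.
move=> s0 /eigenvalueP[v vA v0]; apply/eigenvalueP.
exists (\row_j (v 0 j / s j)).
  apply/rowP => j; rewrite !mxE.
  have /rowP/(_ j) := vA; rewrite !mxE mulrA => <-.
  rewrite mulr_suml; apply: eq_bigr => i _; rewrite !mxE.
  by rewrite !mulrA divfK.
have /rV0Pn[j vj] := v0; apply/rV0Pn; exists j.
by rewrite mxE mulf_neq0 // invr_eq0.
Qed.

(** Used to show that subtracting the projection onto [q] does not affect eigenvectors with nonzero
    eigenvalue. *)
Lemma orthogonal_real_eigenvector (R : realType) n (Q : 'M[R]_n) r (q v : 'rV[R]_n) :
  v *m Q = r *: v -> Q *m q^T = 0 -> r != 0 -> v *m q^T = 0.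
Proof.
move=> vQ Qq r0; have : r *: (v *m q^T) = 0 by rewrite scalemxAl -vQ -mulmxA Qq mulmx0.
by move/eqP; rewrite scaler_eq0 (negPf r0) => /eqP.
Qed.

Section Symmetrization.
Variables (R : realType) (n : nat) (mu : 'rV[R]_n) (P : 'M[R]_n).
Hypotheses (hmu : positive_distribution mu) (hP : transition_matrix P).
Hypotheses (hirr : irreducible_chain P) (haper : aperiodic_chain P).
Hypothesis (hrev : reversible mu P).

Let s x := Num.sqrt (mu 0 x).
Let s_gt0 x : 0 < s x. Proof. by rewrite sqrtr_gt0; exact: hmu.1. Qed.
Let s_neq0 x : s x != 0. Proof. by rewrite gt_eqF. Qed.
Let sqr_s x : s x ^+ 2 = mu 0 x.
Proof. by rewrite sqr_sqrtr // ltW //; exact: hmu.1. Qed.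

Definition symmetrized : 'M[R]_n :=
  \matrix_(x, y) (Num.sqrt (mu 0 x) * P x y / Num.sqrt (mu 0 y)).

Let S := symmetrized.
Let q : 'rV[R]_n := \row_x s x.
Let Q := S - q^T *m q.

Lemma symmetrized_tr : S^T = S.
Proof.
apply/matrixP => x y; rewrite !mxE -/(s x) -/(s y).
apply: (@mulfI _ (s x * s y)); first by rewrite mulf_neq0.
have -> : s x * s y * (s y * P y x / s x) = s y ^+ 2 * P y x by field.
have -> : s x * s y * (s x * P x y / s y) = s x ^+ 2 * P x y by field.
by rewrite !sqr_s hrev.
Qed.

Lemma symmetrized_exp t x y : (S ^+ t) x y = s x * (P ^+ t) x y / s y.
Proof.
elim: t x y => [|t IH] x y.
  rewrite !expr0 !mxE; case: eqP => [->|_]; last by rewrite mulr0 mul0r.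
  by rewrite mulr1 divff.
rewrite !exprS !mxE mulr_sumr mulr_suml; apply: eq_bigr => z _.
by rewrite IH mxE -/(s x) -/(s z); field; rewrite !s_neq0.
Qed.

Let Sq : S *m q^T = q^T.
Proof.
apply/colP => x; rewrite !mxE -[RHS]mulr1 -(hP.2 x) mulr_sumr.
by apply: eq_bigr => y _; rewrite !mxE -/(s x) -/(s y) divfK.
Qed.

Let qS : q *m S = q.
Proof. by apply: trmx_inj; rewrite trmx_mul symmetrized_tr Sq. Qed.

Let qq : q *m q^T = 1%:M.
Proof.
apply/matrixP => i j; rewrite !ord1 !mxE -hmu.2.
by apply: eq_bigr => x _; rewrite !mxE -expr2 sqr_s.
Qed.

Let Q_tr : Q^T = Q.
Proof. by rewrite linearB /= trmx_mul trmxK symmetrized_tr. Qed.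

Let Qq : Q *m q^T = 0.
Proof. by rewrite mulmxBl Sq -mulmxA qq mulmx1 subrr. Qed.

(** [S] fixes [q] on both sides, so the cross terms collapse to the projection [q^T *m q]. The
    exponent is a successor since the zeroth power of [Q] is the identity. *)
Let Q_exp t : Q ^+ t.+1 = S ^+ t.+1 - q^T *m q.
Proof.
have Stq k : S ^+ k *m q^T = q^T.
  elim: k => [|k IH]; first exact: mul1mx.
  by rewrite exprSr -mulmxE -mulmxA Sq IH.
elim: t => [|t IH]; first by rewrite !expr1.
rewrite exprSr IH -mulmxE [in LHS]/Q mulmxBr !mulmxBl.
rewrite -(mulmxA _ q S) qS (mulmxA _ (q^T) q) Stq.
rewrite -(mulmxA _ q) (mulmxA q) qq mul1mx subrr subr0.
by rewrite (exprSr _ t.+1).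
Qed.

Lemma eigenvalue_symmetrized r : eigenvalue S r -> eigenvalue P r.
Proof.
have sV x : (s x)^-1 != 0 by rewrite invr_eq0.
move=> /(eigenvalue_diag_conj sV); congr (eigenvalue _ r).
by apply/matrixP => x y; rewrite !mxE -/(s x) -/(s y); field; rewrite !s_neq0.
Qed.

Lemma eigenvalue_complex_symmetrized z :
  eigenvalue (map_mx (real_complex R) P) z ->
  eigenvalue (map_mx (real_complex R) S) z.
Proof.
have sC x : real_complex R (s x) != 0 by rewrite fmorph_eq0.
move=> /(eigenvalue_diag_conj sC); congr (eigenvalue _ z).
by apply/matrixP => x y; rewrite !mxE rmorphM rmorphM fmorphV.
Qed.

Let spec := [set ComplexField.Normc.normc lam | lam in
  [set lam : R[i] | eigenvalue (map_mx (real_complex R) P) lam /\ lam != 1]]%classic.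

(** Every complex eigenvalue of [P] is one of the finitely many real eigenvalues of [S]; those other
    than 1 have modulus below 1, hence so does their maximum [M]. *)
Lemma lambda_star_range : 0 <= lambda_star P < 1 /\
  forall lam : R[i], eigenvalue (map_mx (real_complex R) P) lam -> lam != 1 ->
    ComplexField.Normc.normc lam <= lambda_star P.
Proof.
have [d [dS Sd _]] := real_symmetric_eigenvalue_diag symmetrized_tr.
have d1 i : `|d 0 i| < 1 \/ d 0 i = 1.
  exact: (reversible_eigenvalue hmu hP haper hrev (eigenvalue_symmetrized (dS i))).
pose M := \big[Num.max/0]_(i | d 0 i != 1) `|d 0 i|.
have M1 : M < 1.
  by apply/bigmax_ltP; split=> // i /eqP; case: (d1 i).
have M0 : 0 <= M by exact: bigmax_ge_id.
have specM : forall lam : R[i], eigenvalue (map_mx (real_complex R) P) lam ->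
    lam != 1 -> ComplexField.Normc.normc lam <= M.
  move=> lam /eigenvalue_complex_symmetrized/Sd[i ->] d1'.
  rewrite normcRE; apply: le_bigmax_cond.
  by apply: contraNneq d1' => ->.
have ubM : ubound spec M by move=> _ [lam [e l1] <-]; exact: specM.
have inspec lam : eigenvalue (map_mx (real_complex R) P) lam -> lam != 1 ->
    spec (ComplexField.Normc.normc lam) by move=> e l1; exists lam.
have lamle : forall lam : R[i], eigenvalue (map_mx (real_complex R) P) lam ->
    lam != 1 -> ComplexField.Normc.normc lam <= lambda_star P.
  move=> lam e l1; apply: ub_le_sup; last exact: inspec.
  by exists M.
split=> //; have [spec0|/nonemptyPn spec0] := pselect (spec !=set0)%classic.
  apply/andP; split; last by apply: le_lt_trans M1; exact: ge_sup.
  have [_ [lam [e l1] _]] := spec0; apply: le_trans (lamle _ e l1).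
  by rewrite -(lecR 0); exact: (normr_ge0 lam).
(* If 1 is the only eigenvalue, the supremum of the empty set is 0 by convention. *)
by rewrite /lambda_star -/spec spec0 sup0 lexx ltr01.
Qed.

Lemma transition_ratio_bound t x y : (0 < t)%N ->
  `|(P ^+ t) x y / mu 0 y - 1| <= lambda_star P ^+ t / min_mass mu.
Proof.
have [/andP[l0 _] specl] := lambda_star_range.
have [d [dQ _ Qd]] := real_symmetric_eigenvalue_diag Q_tr.
have dl i : `|d 0 i| <= lambda_star P.
  have [->|di0] := eqVneq (d 0 i) 0; first by rewrite normr0.
  have /eigenvalueP[v vQ v0] := dQ i.
  have vq := orthogonal_real_eigenvector vQ Qq di0.
  have vS : v *m S = d 0 i *: v.
    by rewrite -vQ mulmxBr mulmxA vq mul0mx subr0.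
  have dS : eigenvalue S (d 0 i) by apply/eigenvalueP; exists v.
  rewrite -normcRE; apply: specl.
    by rewrite eigenvalue_map; exact: eigenvalue_symmetrized.
  (* An eigenvector [v] for 1 would make [v / s] harmonic, hence constant, so [v] would be a
     multiple of [q]; being orthogonal to [q], it would be zero. *)
  apply: contraNneq v0; rewrite -(rmorph1 (real_complex R)) => /complexI d1.
  have vc := @harmonic_const _ _ _ hP hirr (fun x => v 0 x / s x).
  have {}vc z z' : v 0 z / s z = v 0 z' / s z'.
    apply: vc => {z z'} z; rewrite mul1r.
    have := vS; rewrite d1 scale1r => /(congr1 trmx).
    rewrite trmx_mul symmetrized_tr => /colP/(_ z); rewrite !mxE => <-.
    rewrite mulr_suml; apply: eq_bigr => z' _; rewrite !mxE -/(s z) -/(s z').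
    by field; rewrite !s_neq0.
  apply/eqP/rowP => z; rewrite [RHS]mxE.
  have vE z' : v 0 z' = v 0 z / s z * s z' by rewrite (vc z z') divfK.
  have : (v *m q^T) 0 0 = v 0 z / s z.
    rewrite -[RHS]mulr1 -hmu.2 mulr_sumr mxE; apply: eq_bigr => z' _.
    by rewrite vE !mxE -sqr_s mulrA.
  by rewrite vq mxE => /esym/eqP; rewrite mulf_eq0 invr_eq0 (negPf (s_neq0 z)) orbF => /eqP.
case: t => // t _.
have := Qd _ dl t.+1 x y; rewrite Q_exp !mxE big_ord1 symmetrized_exp !mxE.
set p := (P ^+ t.+1) x y => H.
have -> : p / mu 0 y - 1 = (s x * p / s y - s x * s y) / (s x * s y).
  by rewrite -sqr_s; field; rewrite !s_neq0.
rewrite normrM normfV (gtr0_norm (mulr_gt0 (s_gt0 x) (s_gt0 y))).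
have m0 := min_mass_gt0 hmu.1.
apply: ler_pM => //; first by rewrite invr_ge0 ltW // mulr_gt0.
rewrite lef_pV2 ?posrE ?mulr_gt0 //.
rewrite -[leLHS](sqr_sqrtr (ltW m0)) expr2.
by apply: ler_pM; rewrite ?sqrtr_ge0 // ler_wsqrtr // min_mass_le.
Qed.

End Symmetrization.

(** * Real inequalities *)

Section RealInequalities.
Variable R : realType.
Implicit Types (x y f p l M : R).

(** The function [ln z + 4 / (z + 1)] has derivative [(z - 1)^2 / (z (z + 1)^2)], so it is
    nondecreasing from its value 2 at 1. *)
Lemma ln_ge_pade y : 1 <= y -> 2 * (y - 1) / (y + 1) <= ln y.
Proof.
move=> y1; pose g : R -> R := (@ln R) + 4 \*: (fun z : R => (z + 1)^-1).
have dg (z : R) : 0 < z -> is_derive z 1 g ((z - 1) ^+ 2 / (z * (z + 1) ^+ 2)).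
  move=> z0; have z1 : z + 1 != 0 by rewrite gt_eqF // addr_gt0.
  have d1 : is_derive z 1 (fun w : R => w + 1) 1.
    by apply: is_derive_eq; rewrite addr0.
  have H := is_deriveD (is_derive1_ln z0) (is_deriveZ 4
    (@is_deriveV R (fun w => w + 1) z 1 1 z1 d1)).
  apply: (is_derive_eq H).
  rewrite /GRing.scale /=; field; rewrite z1 gt_eqF //.
have y0 : y + 1 != 0 by rewrite gt_eqF //; lra.
have gE (z : R) : g z = ln z + 4 * (z + 1)^-1 by [].
have -> : 2 * (y - 1) / (y + 1) = g 1 - 4 * (y + 1)^-1.
  by rewrite gE ln1 add0r; field.
rewrite lerBlDr -gE.
have := @ger0_derive1_le_cc R g 1 y.
apply; rewrite ?in_itv /= ?lexx ?y1 //.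
- move=> z; rewrite in_itv /= => /andP[z1 _].
  by have [] := dg z (lt_trans ltr01 z1).
- move=> z; rewrite in_itv /= => /andP[z1 _]; have z0 := lt_trans ltr01 z1.
  have [_ H] := dg z z0; rewrite derive1E H.
  by rewrite divr_ge0 ?sqr_ge0 // mulr_ge0 ?sqr_ge0 // ltW.
- apply: derivable_within_continuous => z; rewrite in_itv /= => /andP[z1 _].
  by have [] := dg z (lt_le_trans ltr01 z1).
Qed.

Lemma ln_ge_1BV x : 0 < x -> 1 - x^-1 <= ln x.
Proof.
move=> x0; rewrite -[x in ln x]invrK lnV ?posrE ?invr_gt0 // lerNr opprB.
have := @le_ln1Dx R (x^-1 - 1); rewrite addrCA subrr addr0; apply.
by rewrite ltrBrDr addNr invr_gt0.
Qed.

Lemma ln_le_B1 x : 0 < x -> ln x <= x - 1.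
Proof.
move=> x0; have := @le_ln1Dx R (x - 1); rewrite addrCA subrr addr0; apply.
by rewrite ltrBrDr addNr.
Qed.

Lemma powRE_exp x p : 0 < x -> x `^ p = expR (p * ln x).
Proof. by move=> x0; rewrite /powR gt_eqF. Qed.

(** Concavity of the logarithm: with [m] the right-hand side, the bound [ln u <= u - 1] is taken at
    [x / m] and [1 / m] with weights [p] and [1 - p]. *)
Lemma powR_bernoulli x p : 0 <= x -> 0 <= p <= 1 -> x `^ p <= 1 + p * (x - 1).
Proof.
rewrite le_eqVlt => /orP[/eqP <- /andP[p0 p1]|x0 /andP[p0 p1]].
  have [->|pn0] := eqVneq p 0; first by rewrite powRr0 mul0r addr0.
  by rewrite powR0 // sub0r mulrN1 subr_ge0.
pose m := 1 + p * (x - 1).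
have m0 : 0 < m.
  have [p1'|p1'] := ltrP p 1; first by rewrite /m; nra.
  by rewrite /m; nra.
rewrite powRE_exp // -/m -[leRHS]lnK ?posrE // ler_expR.
have xm := ln_le_B1 (divr_gt0 x0 m0); have vm := ln_le_B1 (divr_gt0 ltr01 m0).
move: xm vm; rewrite !ln_div ?posrE // ln1 => xm vm.
have : p * (ln x - ln m) + (1 - p) * (0 - ln m) <=
    p * (x / m - 1) + (1 - p) * (1 / m - 1).
  by apply: lerD; apply: ler_wpM2l; rewrite ?subr_ge0.
have -> : p * (x / m - 1) + (1 - p) * (1 / m - 1) = 0.
  have -> : p * (x / m - 1) + (1 - p) * (1 / m - 1) = (1 + p * (x - 1)) / m - 1.
    by field; rewrite gt_eqF.
  by rewrite -/m divff ?subrr // gt_eqF.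
by lra.
Qed.

(* The argument yields the constant [expR 2 / 4], of which [15 / 8] is a rational
   upper bound; what matters later is that it is less than 2. *)
Lemma geometric_floor l M : 0 <= l < 1 -> 4 <= M ->
  exists t : nat,
    [/\ (0 < t)%N, t%:R <= ln M / (1 - l) & l ^+ t * M <= 15 / 8].
Proof.
move=> /andP[l0 l1] M4; pose B := ln M / (1 - l).
(* This exceeds 1, so [B >= 1] and its integer part is positive. *)
have ln4 : 6 / 5 <= ln (4 : R).
  have -> : 6 / 5 = 2 * (4 - 1) / (4 + 1) :> R by field.
  by apply: ln_ge_pade; lra.
have L4 : ln 4 <= ln M by rewrite ler_ln ?posrE //; lra.
have B1 : 1 <= B by rewrite ler_pdivlMr; lra.
have /andP[tB Bt] : (Num.truncn B)%:R <= B < (Num.truncn B).+1%:R.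
  by apply: truncn_itv; lra.
exists (Num.truncn B); set t := Num.truncn B in tB Bt *.
have t0 : (0 < t)%N by rewrite truncn_gt0.
split=> //; move: l0; rewrite le_eqVlt => /orP[/eqP <-|l0].
  by rewrite expr0n gtn_eqF // mulr0n mul0r; lra.
have M0 : 0 < M by lra.
rewrite -ler_ln ?posrE ?mulr_gt0 ?exprn_gt0 //.
rewrite lnM ?posrE ?exprn_gt0 // lnXn // -[_ *+ t]mulr_natl.
(* The rational lower bound on the logarithm, taken at [1 / l]. *)
have lnl : 2 * (1 - l) / (1 + l) <= - ln l.
  rewrite -lnV ?posrE //; apply: le_trans (ln_ge_pade _); last first.
    by rewrite invf_ge1 // ltW.
  by rewrite le_eqVlt; apply/orP; left; apply/eqP; field; rewrite !gt_eqF //; lra.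
have tl : (B - 1) * (2 * (1 - l) / (1 + l)) <= t%:R * - ln l.
  apply: ler_pM => //; first by lra.
    by rewrite divr_ge0 //; lra.
  by move: Bt; rewrite -natr1; lra.
have e : (B - 1) * (2 * (1 - l) / (1 + l)) =
    ln M - (1 - l) * (2 - ln M) / (1 + l).
  by rewrite /B; field; rewrite !gt_eqF //; lra.
have up : t%:R * ln l + ln M <= (1 - l) / (1 + l) * (2 - ln M).
  by move: tl; rewrite e mulrN mulrAC; lra.
apply: (le_trans up).
have q1 : 0 <= (1 - l) / (1 + l) <= 1.
  by rewrite divr_ge0 ?ler_pdivrMr //=; lra.
have [M2|M2] := lerP 2 (ln M).
  by apply: (@le_trans _ _ 0); [nra | apply: ln_ge0; lra].
(* This says that e^2 is at most 15/2: [(9/7)^8 <= 15/2] and [ln (9/7) >= 1/4]. *)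
have e2 : 2 <= ln (15 / 8 : R) + ln 4.
  rewrite -lnM ?posrE //.
  apply: (@le_trans _ _ (ln ((9 / 7) ^+ 8 : R))); last first.
    by rewrite ler_ln ?posrE ?exprn_gt0 //; lra.
  rewrite lnXn //.
  have : 1 / 4 <= ln (9 / 7 : R).
    have -> : 1 / 4 = 2 * (9 / 7 - 1) / (9 / 7 + 1) :> R by field.
    by apply: ln_ge_pade; lra.
  by rewrite -mulr_natl; lra.
by apply: (@le_trans _ _ (2 - ln M)); [nra|lra].
Qed.

End RealInequalities.

(** * Pointwise bounds on powers near and away from 1 *)

Section PointwisePowers.
Variable R : realType.
Implicit Types (f a d : R).

Lemma expR_half_le2 : expR (1 / 2) <= 2 :> R.
Proof.
rewrite -[1 / 2]opprK expRN -[leRHS]invrK lef_pV2 ?posrE ?invr_gt0 ?expR_gt0 //.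
by apply: le_trans (expR_ge1Dx _); lra.
Qed.

(** Here [A], the power of [f], lies between 0 and 2, since [a ln f <= a d <= 1/2]. Then
    [A - f <= (a - 1) A (f - 1)], and replacing [A] by 1 costs at most [d]. The remaining [f - 1]
    will average to zero. *)
Lemma powR_sub_id_le f a d : 1 < a -> 0 <= f -> `|f - 1| <= d -> a * d <= 1 / 2 ->
  f `^ a - f <= (a - 1) * (f - 1 + d).
Proof.
move=> a1 f0 /[dup] fd; rewrite ler_norml => /andP[fd1 fd2] ad.
have d0 : 0 <= d by lra.
have {}f0 : 0 < f by nra.
set A := f `^ a; have A0 : 0 < A by exact: powR_gt0.
have A2 : A <= 2.
  apply: le_trans expR_half_le2; rewrite /A powRE_exp // ler_expR.
  have := ln_le_B1 f0; nra.
have fA : 1 - (a - 1) * ln f <= f / A.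
  have -> : f / A = expR (- ((a - 1) * ln f)).
    rewrite /A powRE_exp // -{1}[f]lnK ?posrE // -expRB; congr expR; ring.
  by apply: le_trans (expR_ge1Dx _); lra.
have lnf := ln_le_B1 f0.
have {fA}: A - f <= A * ((a - 1) * (f - 1)).
  have -> : A - f = A * (1 - f / A) by field; rewrite gt_eqF.
  rewrite ler_pM2l //.
  have : (a - 1) * ln f <= (a - 1) * (f - 1) by rewrite ler_pM2l // subr_gt0.
  lra.
move=> H; apply: (le_trans H); rewrite mulrCA ler_pM2l ?subr_gt0 //.
rewrite -lerBlDl -{2}[f - 1]mul1r -mulrBl (le_trans (ler_norm _)) // normrM.
rewrite -[leRHS]mul1r ler_pM // ler_norml; lra.
Qed.

(** Bounding the exponential below by its tangent reduces the claim to [- ln f <= 1 - f + 4 d]. Only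
    [f < 1] is delicate; there [d >= 1 - f] and [f >= 1/16]. *)
Lemma powR_ge_near1 f a d : 0 <= a -> 0 <= f -> `|f - 1| <= d -> d <= 15 / 16 ->
  1 - f `^ a <= a * (1 - f + 4 * d).
Proof.
move=> a0 f0 fd d1; have := fd; rewrite ler_norml => /andP[fd1 fd2].
have {}f0 : 0 < f by lra.
have H : 1 + a * ln f <= f `^ a.
  by rewrite powRE_exp //; exact: expR_ge1Dx.
suff : - ln f <= 1 - f + 4 * d by nra.
have [f1|f1] := lerP 1 f; first by have := ln_ge0 f1; lra.
suff : - ln f <= 1 - f + 4 * (1 - f) by lra.
(* The fourth root turns [f >= 1/16] into [r >= 1/2], and [- ln f] is at most [4 (1/r - 1)]. What
   remains is a polynomial inequality in [r]. *)
pose r := Num.sqrt (Num.sqrt f).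
have r0 : 0 < r by rewrite !sqrtr_gt0.
have rE : r ^+ 4 = f by rewrite (exprM r 2 2) !sqr_sqrtr ?sqrtr_ge0 // ltW.
have r_half : 1 / 2 <= r.
  rewrite -(@ler_pXn2r _ 4) ?nnegrE // ?(ltW r0) // rE; lra.
have r1 : r <= 1 by rewrite -(@ler_pXn2r _ 4) ?nnegrE // ?(ltW r0) // rE; lra.
rewrite -rE lnXn // -[ln r *+ 4]mulr_natl.
have := ln_ge_1BV r0; set v := r^-1 => lv.
have vr : v * r = 1 by rewrite mulVf // gt_eqF.
have v0 : 0 < v by rewrite invr_gt0.
clearbody v.
suff : 4 * (v - 1) <= 5 * (1 - r ^+ 4) by lra.
have -> : 4 * (v - 1) = v * (4 * (1 - r)) by rewrite -{2}vr; ring.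
have -> : 5 * (1 - r ^+ 4) = v * (5 * r * (1 - r ^+ 4)).
  by rewrite -[LHS]mul1r -vr; ring.
rewrite ler_pM2l //.
have -> : 5 * r * (1 - r ^+ 4) = (5 * r * (1 + r + r ^+ 2 + r ^+ 3)) * (1 - r).
  by ring.
apply: ler_wpM2r; first lra.
have r2 : 1 / 4 <= r ^+ 2 by nra.
have r3 : 1 / 8 <= r ^+ 3 by rewrite exprS; nra.
nra.
Qed.

Lemma powR_sqrt f a : 0 <= f -> f `^ a = Num.sqrt f `^ (2 * a).
Proof.
by move=> f0; rewrite -powR12_sqrt // -powRrM mulrA mulVf ?mul1r ?pnatr_eq0.
Qed.

(** Averaged, the left side is twice the Hellinger deficit [1 - E sqrt f]. For [a < 1], Bernoulli
    with exponent [2 a - 1] is applied to [s], the root of [f]; for [a > 1], the tangent bound on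
    the exponential and [ln f >= 2 (1 - 1/s)]. *)
Lemma powR_sub_id_ge f a : 1 / 2 <= a -> a != 1 -> 0 <= f ->
  2 * (f - Num.sqrt f) <= (a - 1)^-1 * (f `^ a - f).
Proof.
move=> a2 a1; rewrite le_eqVlt => /orP[/eqP <-|f0].
  by rewrite sqrtr0 powR0 ?subrr ?mulr0 // gt_eqF //; lra.
pose s : R := Num.sqrt f; have s0 : 0 < s by rewrite sqrtr_gt0.
have sE : f = s ^+ 2 by rewrite sqr_sqrtr // ltW.
rewrite -/s; case/orP: (lt_total a1) => {}a1.
  rewrite ler_ndivlMl ?subr_lt0 // powR_sqrt ?(ltW f0) // -/s.
  have -> : 2 * a = 1 + (2 * a - 1) by ring.
  rewrite powRD ?(gt_eqF s0) ?implybT // powRr1 ?(ltW s0) //.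
  have := @powR_bernoulli R s (2 * a - 1) (ltW s0).
  move=> /(_ ltac:(lra)) /(ler_wpM2l (ltW s0)); clearbody s; rewrite sE; lra.
rewrite ler_pdivlMl ?subr_gt0 //.
have -> : f `^ a = f * expR ((a - 1) * ln f).
  by rewrite powRE_exp // -{2}[f]lnK ?posrE // -expRD; congr expR; ring.
have lnf : 2 * (1 - s^-1) <= ln f.
  by rewrite sE lnXn // -[ln s *+ 2]mulr_natl ler_pM2l // ln_ge_1BV.
have ee := expR_ge1Dx ((a - 1) * ln f).
have : (a - 1) * (2 * (1 - s^-1)) <= (a - 1) * ln f by rewrite ler_pM2l // subr_gt0.
have sv : f * s^-1 = s by rewrite sE expr2 mulfK // gt_eqF.
move=> H; have {}H : 1 + (a - 1) * (2 * (1 - s^-1)) <= expR ((a - 1) * ln f) by lra.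
have := ler_wpM2l (ltW f0) H.
have -> : f * (1 + (a - 1) * (2 * (1 - s^-1))) = f + (a - 1) * 2 * (f - f * s^-1) by ring.
by rewrite sv; lra.
Qed.

(** Covers the exponents below 1/2, where [2 a - 1] is negative but Bernoulli applies with [2 a]. *)
Lemma powR_le_sqrt f a : 0 <= a <= 1 / 2 -> 0 <= f ->
  f `^ a <= 1 + 2 * a * (Num.sqrt f - 1).
Proof.
move=> /andP[a0 a1] f0; rewrite powR_sqrt //.
by apply: powR_bernoulli; rewrite ?sqrtr_ge0 //; lra.
Qed.

End PointwisePowers.

(** * Bounds on the divergence *)

Definition pair_mean (R : realType) n (mu : 'rV[R]_n) (g : 'I_n -> 'I_n -> R) : R :=
  \sum_x mu 0 x * \sum_y mu 0 y * g x y.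

Section AlphaDivergence.
Variables (R : realType) (n : nat) (mu : 'rV[R]_n) (M : 'M[R]_n).
Hypotheses (hmu : positive_distribution mu) (hM : transition_matrix M).
Implicit Types (g h : 'I_n -> 'I_n -> R) (a c d : R).

Let f x y := M x y / mu 0 y.

Let f_ge0 x y : 0 <= f x y.
Proof. by rewrite divr_ge0 ?hM.1 // ltW //; exact: hmu.1. Qed.

Lemma pair_meanD g h : pair_mean mu (fun x y => g x y + h x y) =
  pair_mean mu g + pair_mean mu h.
Proof.
rewrite -big_split; apply: eq_bigr => x _ /=; rewrite -mulrDr; congr (_ * _).
by rewrite -big_split /=; apply: eq_bigr => y _; rewrite mulrDr.
Qed.

Lemma pair_meanZ c g : pair_mean mu (fun x y => c * g x y) = c * pair_mean mu g.
Proof.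
rewrite [RHS]mulr_sumr; apply: eq_bigr => x _; rewrite [RHS]mulrCA.
by congr (_ * _); rewrite mulr_sumr; apply: eq_bigr => y _; rewrite mulrCA.
Qed.

Lemma pair_mean_const c : pair_mean mu (fun _ _ => c) = c.
Proof.
rewrite /pair_mean; under eq_bigr do rewrite -mulr_suml hmu.2 mul1r.
by rewrite -mulr_suml hmu.2 mul1r.
Qed.

Lemma le_pair_mean g h : (forall x y, g x y <= h x y) ->
  pair_mean mu g <= pair_mean mu h.
Proof.
move=> gh; apply: ler_sum => x _; apply: ler_wpM2l; first by rewrite ltW //; exact: hmu.1.
by apply: ler_sum => y _; apply: ler_wpM2l => //; rewrite ltW //; exact: hmu.1.
Qed.

Lemma pair_mean_ratio : pair_mean mu (fun x y => M x y / mu 0 y) = 1.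
Proof.
rewrite -[RHS]hmu.2; apply: eq_bigr => x _; rewrite -[RHS]mulr1 -(hM.2 x).
congr (_ * _); apply: eq_bigr => y _; rewrite mulrC divfK // gt_eqF //.
exact: hmu.1.
Qed.

Lemma alpha_divergenceE a : alpha_divergence mu a M (stationary_mx mu) =
  (a - 1)^-1 * (pair_mean mu (fun x y => (M x y / mu 0 y) `^ a) - 1).
Proof.
rewrite /alpha_divergence /pair_mean; congr (_ * (_ - _)).
by apply: eq_bigr => x _; congr (_ * _); apply: eq_bigr => y _; rewrite !mxE.
Qed.

(** The pointwise bound is averaged; its linear term in [f - 1] has mean zero, which leaves [d]. *)
Lemma alpha_divergence_le_gt1 a d : 1 < a -> a * d <= 1 / 2 ->
  (forall x y, `|M x y / mu 0 y - 1| <= d) ->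
  alpha_divergence mu a M (stationary_mx mu) <= d.
Proof.
move=> a1 ad fd; rewrite alpha_divergenceE ler_pdivrMl ?subr_gt0 //.
have := @le_pair_mean (fun x y => f x y `^ a)
  (fun x y => a * f x y + (a - 1) * (d - 1)).
rewrite pair_meanD pair_meanZ pair_mean_const pair_mean_ratio => H.
suff /H : forall x y, f x y `^ a <= a * f x y + (a - 1) * (d - 1) by rewrite /f; lra.
by move=> x y; have := powR_sub_id_le a1 (f_ge0 x y) (fd x y) ad; lra.
Qed.

(** The prefactor [(a - 1)^-1] is negative, so an upper bound on the divergence needs a lower bound
    on the powers. *)
Lemma alpha_divergence_le_lt1 a d : 0 < a < 1 -> d <= 15 / 16 ->
  (forall x y, `|M x y / mu 0 y - 1| <= d) ->
  alpha_divergence mu a M (stationary_mx mu) <= 4 * a / (1 - a) * d.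
Proof.
move=> /andP[a0 a1] d1 fd; rewrite alpha_divergenceE ler_ndivrMl ?subr_lt0 //.
have -> : (a - 1) * (4 * a / (1 - a) * d) = - (4 * a * d).
  by field; rewrite gt_eqF // subr_gt0.
have := @le_pair_mean (fun x y => a * f x y + (1 - a - 4 * a * d))
  (fun x y => f x y `^ a).
rewrite pair_meanD pair_meanZ pair_mean_const pair_mean_ratio => H.
suff /H : forall x y, a * f x y + (1 - a - 4 * a * d) <= f x y `^ a by rewrite /f; lra.
by move=> x y; have := powR_ge_near1 (ltW a0) (f_ge0 x y) (fd x y) d1; lra.
Qed.

Let T := pair_mean mu (fun x y => `|M x y / mu 0 y - 1|).
Let H : R := 1 - pair_mean mu (fun x y => Num.sqrt (M x y / mu 0 y)).

Lemma hellinger_ge0 : 0 <= H.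
Proof.
rewrite subr_ge0.
have := @le_pair_mean (fun x y => Num.sqrt (f x y)) (fun x y => 1 / 2 * f x y + 1 / 2).
rewrite pair_meanD pair_meanZ pair_mean_const pair_mean_ratio => le_sqrt.
suff /le_sqrt : forall x y, Num.sqrt (f x y) <= 1 / 2 * f x y + 1 / 2.
  by rewrite /f; lra.
move=> x y; have := sqr_sqrtr (f_ge0 x y); set s := Num.sqrt _ => sE.
by have := sqr_ge0 (s - 1); nra.
Qed.

(** In substance Cauchy-Schwarz: for [s] the root of [f], [E (s - 1)^2 = 2 H] and
    [E (s + 1)^2 = 4 - 2 H <= 4]. *)
Lemma total_variation_hellinger : T ^+ 2 <= 8 * H.
Proof.
have H0 := hellinger_ge0.
have T0 : 0 <= T.
  by rewrite -(pair_mean_const 0); apply: le_pair_mean => x y.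
move: T0; rewrite le_eqVlt => /orP[/eqP T0|T0].
  by rewrite -T0 expr0n mulr_ge0.
(* AM-GM: [`|f - 1| = `|s - 1| * (s + 1)] with [s] the square root of [f],
   weighted by [k = 4 / T]. *)
pose k := 4 / T; have k0 : 0 < k by rewrite divr_gt0.
have := @le_pair_mean (fun x y => `|f x y - 1|) (fun x y =>
  (k^-1 - k) * Num.sqrt (f x y) + ((k + k^-1) / 2 * f x y + (k + k^-1) / 2)).
rewrite !pair_meanD !pair_meanZ pair_mean_const pair_mean_ratio => le_amgm.
have {le_amgm} /le_amgm : forall x y, `|f x y - 1| <=
    (k^-1 - k) * Num.sqrt (f x y) + ((k + k^-1) / 2 * f x y + (k + k^-1) / 2).
  move=> x y; have := sqr_sqrtr (f_ge0 x y); set s := Num.sqrt _ => sE.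
  have s0 : 0 <= s by exact: sqrtr_ge0.
  have -> : f x y - 1 = (s - 1) * (s + 1) by rewrite -sE; ring.
  rewrite normrM (ger0_norm (_ : 0 <= s + 1)) ?addr_ge0 //.
  have kv : k * k^-1 = 1 by rewrite divff // gt_eqF.
  have v0 : 0 < k^-1 by rewrite invr_gt0.
  have -> : (k^-1 - k) * s + ((k + k^-1) / 2 * f x y + (k + k^-1) / 2) =
      (k * `|s - 1| ^+ 2 + k^-1 * (s + 1) ^+ 2) / 2.
    by rewrite real_normK ?num_real // -sE; field; rewrite gt_eqF.
  have := sqr_ge0 (k * `|s - 1| - (s + 1)) => /(mulr_ge0 (ltW v0)).
  have -> : k^-1 * (k * `|s - 1| - (s + 1)) ^+ 2 =
      k * `|s - 1| ^+ 2 + k^-1 * (s + 1) ^+ 2 - 2 * (`|s - 1| * (s + 1)).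
    by field; rewrite gt_eqF.
  lra.
rewrite -/T; have -> : pair_mean mu (fun x y => Num.sqrt (f x y)) = 1 - H.
  by rewrite /H opprB addrC subrK.
have -> : k^-1 = T / 4 by rewrite invf_div.
move=> TkH; have {}TkH : T <= k * H + 2 * (T / 4) - T / 4 * H by lra.
have {}TkH : T <= k * H + T / 2.
  by have := mulr_ge0 (ltW T0) H0; lra.
have : T * (T / 2) <= T * (k * H) by rewrite ler_pM2l //; lra.
by rewrite (mulrA T k) (_ : T * k = 4); [lra|rewrite mulrC divfK // gt_eqF].
Qed.

(** For [a >= 1/2] the divergence is at least [2 H]. Below 1/2 it is at least
    [2 a H / (1 - a) >= 2 a H], whence the minimum of 1 and [a]. *)
Lemma alpha_divergence_ge a : 0 < a -> a != 1 ->
  Num.min 1 a / 4 * T ^+ 2 <= alpha_divergence mu a M (stationary_mx mu).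
Proof.
move=> a0 a1; rewrite alpha_divergenceE.
have TH := total_variation_hellinger.
have H0 := hellinger_ge0.
have [a2|a2] := lerP (1 / 2) a.
  apply: (@le_trans _ _ (2 * H)).
    have m1 : Num.min 1 a <= 1 by rewrite ge_min lexx.
    by have := sqr_ge0 T; nra.
  have := @le_pair_mean (fun x y => 2 * (f x y + -1 * Num.sqrt (f x y)))
    (fun x y => (a - 1)^-1 * (f x y `^ a + -1 * f x y)).
  rewrite !pair_meanZ !pair_meanD !pair_meanZ pair_mean_ratio /H => le_pow.
  have /le_pow : forall x y, 2 * (f x y + -1 * Num.sqrt (f x y)) <=
      (a - 1)^-1 * (f x y `^ a + -1 * f x y).
    by move=> x y; rewrite !mulN1r; exact: powR_sub_id_ge.
  by rewrite mulN1r mulr1.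
have am : Num.min 1 a = a by rewrite min_r //; lra.
rewrite am ler_ndivlMl; last lra.
have := @le_pair_mean (fun x y => f x y `^ a)
  (fun x y => 2 * a * Num.sqrt (f x y) + (1 - 2 * a)).
rewrite pair_meanD pair_meanZ pair_mean_const => le_pow.
have /le_pow : forall x y, f x y `^ a <= 2 * a * Num.sqrt (f x y) + (1 - 2 * a).
  move=> x y; have := @powR_le_sqrt R (f x y) a.
  by move=> /(_ ltac:(lra) (f_ge0 x y)); lra.
have -> : pair_mean mu (fun x y => Num.sqrt (f x y)) = 1 - H.
  by rewrite /H opprB addrC subrK.
move=> le_pow'.
have : pair_mean mu (fun x y => f x y `^ a) - 1 <= - (2 * a * H).
  by apply: (le_trans (lerB le_pow' (lexx 1))); lra.
move=> /le_trans; apply; rewrite -lerN2 opprK -mulNr opprB.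
have : a / 4 * T ^+ 2 <= 2 * a * H by have := ler_wpM2l (ltW a0) TH; lra.
apply: le_trans; have Ta : 0 <= a / 4 * T ^+ 2.
  by rewrite mulr_ge0 ?sqr_ge0 // divr_ge0 // ltW.
by rewrite -[leRHS]mul1r ler_wpM2r //; lra.
Qed.

End AlphaDivergence.

(** * Spectral lower bound on the total variation *)

Lemma eigenvector_exp (F : fieldType) n (A : 'M[F]_n) (v : 'rV[F]_n) z t :
  v *m A = z *: v -> v *m A ^+ t = z ^+ t *: v.
Proof.
move=> vA; elim: t => [|t IH]; first by rewrite expr0 scale1r; exact: mulmx1.
by rewrite exprSr -mulmxE mulmxA IH -scalemxAl vA scalerA -exprSr.
Qed.

Section EigenvalueLowerBound.
Variables (R : realType) (n : nat) (mu : 'rV[R]_n) (P : 'M[R]_n).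
Hypotheses (hmu : positive_distribution mu) (hP : transition_matrix P).

Let T t := pair_mean mu (fun x y => `|(P ^+ t) x y / mu 0 y - 1|).

Lemma pair_mean_total_variation t :
  T t = \sum_x mu 0 x * \sum_y `|(P ^+ t) x y - mu 0 y|.
Proof.
apply: eq_bigr => x _; congr (_ * _); apply: eq_bigr => y _.
have y0 : 0 < mu 0 y by exact: hmu.1.
rewrite -[X in X * _](gtr0_norm y0) -normrM; congr `|_|.
by field; rewrite gt_eqF.
Qed.

(* Row eigenvectors for [lam != 1] have total mass zero, hence are annihilated
   by [stationary_mx mu], so [lam ^+ t] is an eigenvalue of [P ^+ t - stationary_mx mu]. *)
Lemma eigenvalue_total_variation (lam : R[i]) t :
  eigenvalue (map_mx (real_complex R) P) lam -> lam != 1 ->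
  ComplexField.Normc.normc lam ^+ t * min_mass mu <= T t.
Proof.
move=> /eigenvalueP[v vP v0] lam1.
have sv0 : \sum_x v 0 x = 0.
  have : lam * \sum_x v 0 x = \sum_x v 0 x.
    rewrite mulr_sumr.
    transitivity (\sum_y \sum_x v 0 x * real_complex R (P x y)).
      apply: eq_bigr => y _; have /rowP/(_ y) := vP; rewrite !mxE => <-.
      by apply: eq_bigr => x _; rewrite mxE.
    rewrite exchange_big /=; apply: eq_bigr => x _.
    by rewrite -mulr_sumr -rmorph_sum hP.2 rmorph1 mulr1.
  move/eqP; rewrite -subr_eq0 -[X in _ - X]mul1r -mulrBl mulf_eq0.
  by rewrite subr_eq0 (negPf lam1) => /eqP.
have vt y : lam ^+ t * v 0 y =
    \sum_x v 0 x * real_complex R ((P ^+ t) x y - mu 0 y).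
  have /rowP/(_ y) := eigenvector_exp t vP; rewrite !mxE => <-.
  under [RHS]eq_bigr do rewrite rmorphB mulrBr.
  rewrite sumrB -[X in _ - X]mulr_suml sv0 mul0r subr0.
  by apply: eq_bigr => x _; rewrite -(map_mxX (real_complex R)) mxE.
(* The argument compares l1 norms: [W] times the t-th power of the modulus of [lam] is at most a
   combination, with weights the moduli of [v 0 x], of row distances; each row distance times
   [min_mass mu] is at most [T t]. *)
pose W := \sum_y `|v 0 y|.
have W0 : 0 < W.
  have /rV0Pn[y vy] := v0; rewrite /W (bigD1 y) //=.
  by rewrite ltr_wpDr ?normr_gt0 // sumr_ge0.
rewrite -lecR -(ler_pM2l W0) mulr_suml [leRHS]mulr_suml.
have m0 := min_mass_gt0 hmu.1.
have DT x : (\sum_y `|(P ^+ t) x y - mu 0 y|) * min_mass mu <= T t.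
  rewrite pair_mean_total_variation [leRHS](bigD1 x) //= mulrC.
  have nn z : 0 <= \sum_y `|(P ^+ t) z y - mu 0 y| by exact: sumr_ge0.
  apply: (le_trans (ler_wpM2r (nn x) (min_mass_le mu x))); rewrite lerDl.
  by apply: sumr_ge0 => z _; rewrite mulr_ge0 // ltW //; exact: hmu.1.
apply: (@le_trans _ _ (\sum_x `|v 0 x| *
    real_complex R ((\sum_y `|(P ^+ t) x y - mu 0 y|) * min_mass mu))); last first.
  by apply: ler_sum => x _; rewrite ler_wpM2l // lecR.
apply: (@le_trans _ _ (\sum_y (\sum_x `|v 0 x| *
    real_complex R `|(P ^+ t) x y - mu 0 y|) * real_complex R (min_mass mu))).
  apply: ler_sum => y _; rewrite rmorphM mulrA ler_wpM2r ?ler0c ?(ltW m0) //.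
  have -> : `|v 0 y| * real_complex R (ComplexField.Normc.normc lam ^+ t) =
      `|lam ^+ t * v 0 y|.
    by rewrite normrM normrX rmorphXn mulrC.
  rewrite vt; apply: (le_trans (ler_norm_sum _ _ _)); apply: ler_sum => x _.
  by rewrite normrM -normcRE.
under eq_bigr do rewrite mulr_suml.
rewrite exchange_big /=; apply: ler_sum => x _.
by under eq_bigr do rewrite -mulrA -rmorphM; rewrite -mulr_sumr -rmorph_sum mulr_suml.
Qed.

(** To pass to the supremum, the t-th root [c] of [T t / min_mass mu] serves as a common upper bound
    on the moduli. With no eigenvalue other than 1 the supremum is 0, and so is its t-th power as
    [t > 0]. *)
Lemma lambda_star_total_variation t : (0 < t)%N ->
  lambda_star P ^+ t * min_mass mu <= T t.
Proof.
move=> t0; have m0 := min_mass_gt0 hmu.1; rewrite -ler_pdivlMr //.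
have T0 : 0 <= T t / min_mass mu.
  rewrite divr_ge0 ?(ltW m0) // -(pair_mean_const hmu 0).
  exact: le_pair_mean.
rewrite /lambda_star; set spec := (X in sup X).
have [spec0|/nonemptyPn ->] := pselect (spec !=set0)%classic; last first.
  by rewrite sup0 expr0n gtn_eqF.
pose c := (T t / min_mass mu) `^ (t%:R^-1).
have ct : c ^+ t = T t / min_mass mu.
  rewrite -powR_mulrn ?powR_ge0 // -powRrM mulVf ?powRr1 //.
  by rewrite pnatr_eq0 -lt0n.
have nn (z : R[i]) : 0 <= ComplexField.Normc.normc z.
  by rewrite -(lecR 0); exact: (normr_ge0 z).
have ub : ubound spec c.
  move=> _ [lam [e l1] <-]; rewrite -(@ler_pXn2r _ t) ?nnegrE ?powR_ge0 //.
  by rewrite ct ler_pdivlMr //; exact: eigenvalue_total_variation.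
have s0 : 0 <= sup spec.
  have [z sz] := spec0; have [lam _ zE] := sz.
  apply: (@le_trans _ _ z); first by rewrite -zE.
  by apply: ub_le_sup => //; exists c.
rewrite -ct lerXn2r ?nnegrE ?powR_ge0 //; exact: ge_sup.
Qed.

End EigenvalueLowerBound.

(** * From divergence bounds to mixing times *)

Lemma inv_ln_gap_le (R : realType) (l K eps : R) t : 0 <= l < 1 -> 0 < K -> 0 < eps ->
  K * (l ^+ t) ^+ 2 <= eps ->
  inv_ln_gap (1 - l) / 2 * (ln K + ln (1 / eps)) <= t%:R.
Proof.
move=> /andP[l0 l1] K0 e0 Kl; rewrite /inv_ln_gap subKr.
(* For [l = 0] the prefactor is 0 by convention; otherwise one takes logarithms and divides by
   [2 ln (1 / l) > 0]. *)
case: eqP => [_|/eqP g1]; first by rewrite mul0r mul0r.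
have {}l0 : 0 < l.
  rewrite lt_def l0 andbT; apply: contraNneq g1 => ->.
  by rewrite subr0.
have a0 : 0 < ln (1 / l) by rewrite ln_gt0 // div1r invf_gt1.
rewrite mulrAC ler_pdivrMr // mulrC ler_pdivrMr //.
rewrite ln_div ?posrE // ln1 sub0r ln_div ?posrE // ln1 sub0r.
have lt0 : 0 < (l ^+ t) ^+ 2 by rewrite !exprn_gt0.
have : ln (K * (l ^+ t) ^+ 2) <= ln eps by rewrite ler_ln ?posrE // mulr_gt0.
rewrite lnM ?posrE // -exprM lnXn // -[ln l *+ _]mulr_natr natrM.
lra.
Qed.

Section MixingTime.
Variables (R : realType) (n : nat) (mu : 'rV[R]_n) (P : 'M[R]_n) (alpha eps : R).
Hypotheses (hn : (1 < n)%N) (hmu : positive_distribution mu).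
Hypotheses (hP : transition_matrix P) (hirr : irreducible_chain P).
Hypotheses (haper : aperiodic_chain P) (hrev : reversible mu P).
Hypotheses (halpha0 : 0 < alpha) (heps0 : 0 < eps).

Let l := lambda_star P.
Let m := min_mass mu.
Let m0 : 0 < m. Proof. exact: min_mass_gt0 hmu.1. Qed.
Let l_range : 0 <= l < 1.
Proof. by have [] := lambda_star_range hmu hP haper hrev. Qed.

(** Common to both ranges of [alpha]: with [A / eps] as the [M] of [geometric_floor], the deviation
    [d = l^t / m] satisfies [d A m <= 15/8 eps]. *)
Lemma mixing_time_le A : 0 < A -> 4 * eps <= A ->
  (forall d, 0 <= d -> d * (A * m) <= 15 / 8 * eps ->
     forall M : 'M[R]_n, transition_matrix M ->
       (forall x y, `|M x y / mu 0 y - 1| <= d) ->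
     alpha_divergence mu alpha M (stationary_mx mu) < eps) ->
  (mixing_time mu alpha eps P <=
    (1 / abs_spectral_gap P * (ln A + ln (1 / eps)))%:E)%E.
Proof.
move=> A0 A4 smallD; have M4 : 4 <= A / eps by rewrite ler_pdivlMr.
have [t [t0 tB lt]] := geometric_floor l_range M4.
apply: (@le_trans _ _ (t%:R)%:E).
  apply: ereal_inf_lbound; exists t => //; split=> //.
  apply: (smallD (l ^+ t / m)).
  - by rewrite divr_ge0 ?exprn_ge0 ?(ltW m0) //; case/andP: l_range.
  - have -> : l ^+ t / m * (A * m) = l ^+ t * (A / eps) * eps.
      by field; rewrite !gt_eqF.
    by rewrite ler_pM2r.
  - exact: transition_matrix_exp.
  - by move=> x y; exact: transition_ratio_bound.
by rewrite lee_fin -lnM ?posrE ?divr_gt0 // mul1r mulrC mulrA mulr1.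
Qed.

(** At any admissible time the divergence is at least [min(1, alpha) / 4 * (l^t m)^2], so any [K] up
    to [min(1, alpha) m^2 / 4] works. *)
Lemma mixing_time_ge K : 0 < K -> alpha != 1 ->
  4 * K <= Num.min 1 alpha * m ^+ 2 ->
  ((inv_ln_gap (abs_spectral_gap P) / 2 * (ln K + ln (1 / eps)))%:E
    <= mixing_time mu alpha eps P)%E.
Proof.
move=> K0 alpha1 Km; apply: le_ereal_inf_tmp => _ [t [t0 Dt] <-].
rewrite lee_fin; apply: inv_ln_gap_le => //.
have hPt := transition_matrix_exp t hP.
have := alpha_divergence_ge hmu hPt halpha0 alpha1.
have := lambda_star_total_variation hmu hP t0; rewrite -/l -/m.
set T := pair_mean _ _ => lT DT.
have {}DT := le_lt_trans DT Dt.
have l0 : 0 <= l ^+ t by rewrite exprn_ge0 //; case/andP: l_range.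
have lT2 : (l ^+ t * m) ^+ 2 <= T ^+ 2.
  by rewrite lerXn2r ?nnegrE ?mulr_ge0 ?(ltW m0) //; apply: le_trans lT; rewrite mulr_ge0 // ltW.
have a0 : 0 <= Num.min 1 alpha by rewrite le_min ler01 ltW.
have := ler_wpM2r (sqr_ge0 (l ^+ t)) Km.
have := ler_wpM2l a0 lT2; rewrite exprMn; lra.
Qed.

End MixingTime.

Theorem theorem4p3 (R : realType) (n : nat) (mu : 'rV[R]_n) (P : 'M[R]_n)
    (alpha eps : R)
    (hn : (1 < n)%N)
    (hmu : positive_distribution mu)
    (hP : transition_matrix P)
    (hirr : irreducible_chain P)
    (haper : aperiodic_chain P)
    (hrev : reversible mu P)
    (halpha0 : 0 < alpha) (halpha1 : alpha != 1)
    (heps0 : 0 < eps)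
    (heps : eps < Num.min (1 / (2 * `|alpha - 1|)) (4 * alpha / `|alpha - 1|)) :
  (mixing_time mu alpha eps P <=
     (if 1 < alpha then
        1 / abs_spectral_gap P *
          (ln (2 * alpha / ((alpha - 1) * min_mass mu)) + ln (1 / eps))
      else
        1 / abs_spectral_gap P *
          (ln (8 * alpha / ((1 - alpha) * min_mass mu)) + ln (1 / eps)))%:E)%E
  /\
  ((if 1 < alpha then
      inv_ln_gap (abs_spectral_gap P) / 2 *
        (ln (min_mass mu ^+ 2 / 8) + ln (1 / eps))
    else
      inv_ln_gap (abs_spectral_gap P) / 2 *
        (ln (min_mass mu ^+ 2 * alpha / 16) + ln (1 / eps)))%:E
   <= mixing_time mu alpha eps P)%E.
Proof.
have m0 := min_mass_gt0 hmu.1; have m2 := min_mass_le_half hn hmu.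
set m := min_mass mu in m0 m2 *.
move: heps; rewrite lt_min => /andP[].
have [a1|a1] := ltrP 1 alpha => heps1 heps2.
  have b0 : 0 < alpha - 1 by rewrite subr_gt0.
  have eb : eps * (2 * (alpha - 1)) < 1.
    by move: heps1; rewrite ltr_pdivlMr // mulr_gt0.
  split; last first.
    apply: mixing_time_ge => //; first by rewrite divr_gt0 ?exprn_gt0.
    by rewrite min_l ?(ltW a1) // -/m; have := sqr_ge0 m; lra.
  have Am : 2 * alpha / ((alpha - 1) * m) * m = 2 * alpha / (alpha - 1).
    by field; rewrite !gt_eqF.
  apply: mixing_time_le => //.
  - by rewrite divr_gt0 ?mulr_gt0.
  - by rewrite ler_pdivlMr ?mulr_gt0 //; nra.
  (* The hypothesis reads [alpha d <= 15/16 eps (alpha - 1)]. This is below 15/32 by the first bound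
     on [eps], and it also gives [d < eps]. *)
  - move=> d d0; rewrite Am mulrA ler_pdivrMr // => dle M hM hd.
    have ad : alpha * d <= 1 / 2 by lra.
    apply: le_lt_trans (alpha_divergence_le_gt1 hmu hM a1 ad hd) _.
    nra.
have {}a1 : alpha < 1 by rewrite lt_neqAle halpha1.
have b0 : 0 < 1 - alpha by rewrite subr_gt0.
have eb : eps * (1 - alpha) < 4 * alpha.
  by move: heps2; rewrite ltr_pdivlMr.
split; last first.
  apply: mixing_time_ge => //; first by rewrite divr_gt0 ?mulr_gt0 ?exprn_gt0.
  rewrite min_r ?(ltW a1) // -/m; have := mulr_ge0 (ltW halpha0) (sqr_ge0 m); lra.
have Am : 8 * alpha / ((1 - alpha) * m) * m = 8 * alpha / (1 - alpha).
  by field; rewrite !gt_eqF.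
apply: mixing_time_le => //.
- by rewrite divr_gt0 ?mulr_gt0.
(* Here [m <= 1/2] matters: [4 eps (1 - alpha) m < 16 alpha m <= 8 alpha]. *)
- by rewrite ler_pdivlMr ?mulr_gt0 //; nra.
- move=> d d0; rewrite Am mulrA ler_pdivrMr // => dle M hM hd.
  (* From [8 alpha d <= 15/8 eps (1 - alpha)] and [eps (1 - alpha) < 4 alpha]. *)
  have d1 : d <= 15 / 16 by rewrite -(ler_pM2r halpha0); lra.
  have a01 : 0 < alpha < 1 by rewrite halpha0.
  apply: le_lt_trans (alpha_divergence_le_lt1 hmu hM a01 d1 hd) _.
  rewrite mulrAC ltr_pdivrMr //; nra.
Qed.
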